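(* Let $N\ge 2$ and let $\Omega\subset\mathbb{R}^N$ be a Lipschitz domain with $0\in\partial\Omega$, whose boundary is smooth around the origin, and such that $\Omega\subset\mathbb{R}^N_+=\{x\in\mathbb{R}^N: x_N>0\}$. If $L$ is a positive number such that $L>\sup_{x\in\overline\Omega}|x|$, then for any $v\in H_0^1(\Omega)$, $$\int_\Omega|\nabla v|^2\,dx\ \ge\ \frac{N^2}{4}\int_\Omega\frac{v^2}{|x|^2}\,dx+\frac14\int_\Omega\frac{v^2}{|x|^2\log^2(L/|x|)}\,dx .$$
   Context: $x_N$ denotes the last coordinate of $x\in\mathbb{R}^N$. The existence of $L$ means in particular that $\Omega$ is bounded. *)

(* Defs.v *)
From HB Require Import structures.
From mathcomp Require Import all_boot all_order all_algebra.
From mathcomp Require Import all_classical all_reals all_analysis.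

Set Implicit Arguments.
Unset Strict Implicit.
Unset Printing Implicit Defensive.

Import Order.TTheory GRing.Theory Num.Theory.
Import numFieldNormedType.Exports.

Local Open Scope classical_set_scope.
Local Open Scope ring_scope.

Definition measure_row_display : measure_display -> measure_display.
Proof. exact. Qed.

(* The product sigma-algebra: for T = R this is the Borel sigma-algebra. *)
Section measurable_row.
Context {d} {T : measurableType d} (n : nat).

Let coors : 'I_n -> 'rV[T]_n -> T := fun i x => x ord0 i.

Let row_set0 : g_sigma_preimage coors set0.
Proof. exact: sigma_algebra0. Qed.

Let row_setC A : g_sigma_preimage coors A -> g_sigma_preimage coors (~` A).
Proof. exact: sigma_algebraC. Qed.

Let row_bigcup (F : (set 'rV[T]_n)^nat) :
  (forall i, g_sigma_preimage coors (F i)) ->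
  g_sigma_preimage coors (\bigcup_i (F i)).
Proof. exact: sigma_algebra_bigcup. Qed.

HB.instance Definition _ := @isMeasurable.Build (measure_row_display d)
  'rV[T]_n (g_sigma_preimage coors) row_set0 row_setC row_bigcup.

End measurable_row.

Lemma measurable_coord d (T : measurableType d) n (i : 'I_n) :
  measurable_fun [set: 'rV[T]_n] (fun x : 'rV[T]_n => x ord0 i).
Proof.
move=> _ Y mY; rewrite setTI; apply: sub_sigma_algebra => /=.
rewrite -bigcup_seq/=; exists i => /=; first by rewrite mem_index_enum.
by exists Y => //; rewrite setTI.
Qed.

Lemma measurable_fun_row d1 d2 (T1 : measurableType d1)
    (T2 : measurableType d2) n (f : T1 -> 'rV[T2]_n) :
  (forall i, measurable_fun [set: T1] (fun x => f x ord0 i)) ->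
  measurable_fun [set: T1] f.
Proof.
move=> mf; pose c (i : 'I_n) (x : 'rV[T2]_n) := x ord0 i.
suff H : g_sigma_preimage (fun i => c i \o f) `<=` measurable.
  move=> _ A mA; apply: H; rewrite g_sigma_preimage_comp.
  by exists A.
apply: smallest_sub; first exact: sigma_algebra_measurable.
rewrite -bigcup_seq; apply: bigcup_sub => i _ A [B mB <-].
exact: mf.
Qed.

Section lebesgue_row.
Context {R : realType}.

Definition row_cons n (p : measurableTypeR R * 'rV[R]_n) : 'rV[R]_n.+1 :=
  row_mx (const_mx p.1 : 'rV_1) p.2.

Lemma measurable_row_cons n : measurable_fun setT (@row_cons n).
Proof.
apply: measurable_fun_row => i.
have [j ->|j ->] := @split_ordP 1 n i.
  rewrite (_ : (fun _ => _) = fst) //.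
  by apply/funext => p; rewrite [LHS]row_mxEl mxE.
rewrite (_ : (fun _ => _) = (fun x : 'rV[R]_n => x ord0 j) \o snd); last first.
  by apply/funext => p; rewrite [LHS]row_mxEr.
apply: measurableT_comp => //; exact: measurable_coord.
Qed.

Section step.
Local Open Scope ereal_scope.
Context n (m : {sigma_finite_measure set 'rV[R]_n -> \bar R}).

Definition row_cons_measure : set 'rV[R]_n.+1 -> \bar R :=
  pushforward (lebesgue_measure \x m) (@row_cons n).

Let pushforward_row_cons : {measure set 'rV[R]_n.+1 -> \bar R}.
Proof.
refine (pushforward (lebesgue_measure \x m) (@row_cons n)).
exact: measurable_row_cons.
Defined.

HB.instance Definition _ := Measure.copy row_cons_measure pushforward_row_cons.

Let split_row (x : 'rV[R]_n.+1) : measurableTypeR R * 'rV[R]_n :=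
  (x ord0 ord0, \row_j x ord0 (rshift 1 j)).

Let measurable_split_row : measurable_fun setT split_row.
Proof.
apply/measurable_fun_pairP; split; first exact: measurable_coord.
apply: measurable_fun_row => j; rewrite (_ : (fun _ => _) =
  (fun x : 'rV[R]_n.+1 => x ord0 (rshift 1 j))); first exact: measurable_coord.
by apply/funext => x /=; rewrite mxE.
Qed.

Let row_consK : cancel (@row_cons n) split_row.
Proof.
move=> [a x]; rewrite /split_row /row_cons; congr pair.
  rewrite (_ : ord0 = lshift n (ord0 : 'I_1)); last exact/val_inj.
  by rewrite [LHS]row_mxEl mxE.
by apply/rowP => j; rewrite mxE [LHS]row_mxEr.
Qed.

Let row_cons_measure_sigma_finite : sigma_finite setT row_cons_measure.
Proof.
have /sigma_finiteP[F [TF ndF Foo]] := sigma_finiteT (@lebesgue_measure R).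
have /sigma_finiteP[G [TG ndG Goo]] := sigma_finiteT m.
exists (fun k => split_row @^-1` (F k `*` G k)).
  rewrite -preimage_bigcup (_ : \bigcup_k _ = setT) ?preimage_setT//.
  apply/seteqP; split => // -[x y] _.
  have [i _ Fix] : (\bigcup_k F k) x by rewrite -TF.
  have [j _ Gjy] : (\bigcup_k G k) y by rewrite -TG.
  exists (maxn i j) => //; split => /=.
    by move: x Fix; exact/subsetPset/ndF/leq_maxl.
  by move: y Gjy; exact/subsetPset/ndG/leq_maxr.
move=> k; have [mF Fk] := Foo k; have [mG Gk] := Goo k; split.
  rewrite -[X in measurable X]setTI; apply: measurable_split_row => //.
  exact: measurableX.
rewrite /row_cons_measure /pushforward (_ : _ @^-1` _ = F k `*` G k).
  by rewrite product_measure1E// lte_mul_pinfty// ge0_fin_numE.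
rewrite -comp_preimage (_ : split_row \o @row_cons n = id) //.
by apply/funext => p; exact: row_consK.
Qed.

HB.instance Definition _ := @Measure_isSigmaFinite.Build _ _ _
  row_cons_measure row_cons_measure_sigma_finite.

End step.

(* The n-fold product of the one-dimensional Lebesgue measure. *)
Fixpoint lebesgue_row n : {sigma_finite_measure set 'rV[R]_n -> \bar R} :=
  if n is k.+1 then row_cons_measure (lebesgue_row k) else \d_(0 : 'rV[R]_0).

End lebesgue_row.

Section calculus.
Context {R : realType}.

(* The norm of the normed module 'rV[R]_n is the sup norm, hence this one. *)
Definition enorm n (x : 'rV[R]_n) : R := Num.sqrt (\sum_i x ord0 i ^+ 2).

Definition partial n (i : 'I_n) (f : 'rV[R]_n -> R) : 'rV[R]_n -> R :=
  fun x => 'D_(delta_mx ord0 i) f x.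

Definition grad n (f : 'rV[R]_n -> R) : 'rV[R]_n -> 'rV[R]_n :=
  fun x => \row_i partial i f x.

(* C^infinity: all the iterated partial derivatives exist and are continuous. *)
Definition smooth n (f : 'rV[R]_n -> R) : Prop :=
  forall s : seq 'I_n,
    continuous (foldr (@partial n) f s) /\
    forall x i, derivable (foldr (@partial n) f s) x (delta_mx ord0 i).

Definition test_function n (Om : set 'rV[R]_n) (phi : 'rV[R]_n -> R) : Prop :=
  [/\ smooth phi,
      compact (closure [set x | phi x != 0]) &
      closure [set x | phi x != 0] `<=` Om].

End calculus.

Section domains.
Context {R : realType} {n : nat}.
Implicit Types (Om : set 'rV[R]_n.+1) (p : 'rV[R]_n.+1).

Definition boundary Om : set 'rV[R]_n.+1 := closure Om `\` Om°.

(* After the orthogonal change of coordinates Q, Om coincides near p with the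
   region above the graph of gamma. *)
Definition epigraph_near Om p (Q : 'M[R]_n.+1) (gamma : 'rV[R]_n -> R) : Prop :=
  Q *m Q^T = 1%:M /\
  \forall x \near p,
    Om x <-> gamma (col' ord_max (x *m Q)) < (x *m Q) ord0 ord_max.

(* Lipschitz continuity is for the sup norm; as all norms on 'rV[R]_n are
   equivalent, this is the usual notion. *)
Definition lipschitz_domain Om : Prop :=
  [/\ open Om, connected Om &
      forall p, boundary Om p ->
        exists Q gamma, epigraph_near Om p Q gamma /\ lipschitz gamma].

Definition smooth_boundary_at Om p : Prop :=
  exists Q gamma, epigraph_near Om p Q gamma /\ smooth gamma.

End domains.

Section sobolev.
Context {R : realType} {n : nat}.
Implicit Types (Om : set 'rV[R]_n) (v : 'rV[R]_n -> R) (g : 'rV[R]_n -> 'rV[R]_n).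

Local Notation leb := (lebesgue_row n).

Definition L2 Om v : Prop :=
  measurable_fun Om v /\ (\int[leb]_(x in Om) (v x ^+ 2)%:E < +oo)%E.

Definition weak_gradient Om v g : Prop :=
  forall phi, test_function Om phi -> forall i,
    (\int[leb]_(x in Om) (v x * partial i phi x)%:E =
     - \int[leb]_(x in Om) (g x ord0 i * phi x)%:E)%E.

(* An element of H^1(Om) is represented by a function v together with its
   (a.e. unique) distributional gradient g. *)
Definition H1 Om v g : Prop :=
  [/\ L2 Om v, forall i, L2 Om (fun x => g x ord0 i) & weak_gradient Om v g].

Definition H1_sqnorm Om v g : \bar R :=
  (\int[leb]_(x in Om) (v x ^+ 2)%:E +
   \int[leb]_(x in Om) (enorm (g x) ^+ 2)%:E)%E.

(* The closure of C_c^infinity(Om) in H^1(Om). *)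
Definition H10 Om v g : Prop :=
  H1 Om v g /\
  forall e : R, 0 < e -> exists2 phi, test_function Om phi &
    (H1_sqnorm Om (v \- phi)%R (g \- grad phi)%R < e%:E)%E.

End sobolev.

(* Main.v *)
Require Import Defs.
From mathcomp Require Import all_boot all_order all_algebra.
From mathcomp Require Import all_classical all_reals all_analysis.
From mathcomp Require Import measurable_realfun ring lra.
Import Order.TTheory GRing.Theory Num.Theory.
Import numFieldNormedType.Exports.
Local Open Scope classical_set_scope.
Local Open Scope ring_scope.

(** The proof is the ground state (Jacobi) method. Write
    [q = |x|^2], [l = log (L / |x|)], and let

      [w(x) = x_N |x|^(-N/2) l^(1/2)],

    a positive function on [Om], since there [x_N > 0] and [0 < |x| < L]. It
    solves [- Laplacian w = V w] for the weight of the theorem,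
    [V = (N^2/4) / |x|^2 + (1/4) / (|x|^2 l^2)]. Only its logarithmic gradient
    [F = grad w / w] enters, for which the equation reads [V = - div F - |F|^2]:
    this is the field [drift], and the identity is [drift_identity].

    For a test function [phi] supported in [Om],

      [|grad phi|^2 - V phi^2 - div (phi^2 F) = |grad phi - phi F|^2 >= 0],

    and the integral of [div (phi^2 F)] vanishes because [phi^2 F], extended by
    zero, is a compactly supported field with continuous partial derivatives.
    This is [hardy_vector_field]. The vanishing of the integral of a partial
    derivative ([integral_partial_eq0]) follows from Fubini's theorem and the
    one-dimensional fundamental theorem of calculus.

    To pass to the closure of the test functions ([hardy_closure]), the weight
    is truncated at height [k]: for a bounded weight both sides of the
    inequality are continuous for the [H^1] norm, and the truncation is removed
    by monotone convergence. *)

(** * Measurability of continuous functions of several variables *)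

Section measurability.
Context {R : realType} {n : nat}.

Lemma measurable_ball_row (c : 'rV[R]_n) (r : R) :
  0 < r -> measurable (ball c r).
Proof.
move=> r0.
rewrite (_ : ball c r = \bigcap_(i in [set: 'I_n])
    ((fun x : 'rV[R]_n => x ord0 i) @^-1` (ball (c ord0 i) r))).
  apply: fin_bigcap_measurable => // i _.
  rewrite -[X in measurable X]setTI.
  by apply: measurable_coord => //; rewrite ball_itv; exact: measurable_itv.
apply/seteqP; split=> x /=.
  by move=> [_ cx] i _; exact: cx.
by move=> cx; split => // i j; rewrite ord1; exact: cx.
Qed.

(** The sigma-algebra on row vectors is the product one, so openness has to be
    turned into measurability by hand: an open set is the union of the sup-norm
    balls with rational centre and radius that it contains, and these are
    countably many boxes. *)
Lemma open_measurable_row (U : set 'rV[R]_n) : open U -> measurable U.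
Proof.
move=> oU.
pose B (p : 'rV[rat]_n * rat) : set 'rV[R]_n :=
  if `[< 0 < (ratr p.2 : R) /\
    ball (map_mx (@ratr R) p.1) (ratr p.2 : R) `<=` U >]
  then ball (map_mx (@ratr R) p.1) (ratr p.2 : R) else set0.
rewrite (_ : U = \bigcup_(p in setT) B p).
  apply: countable_bigcupT_measurable => // p.
  by rewrite /B; case: asboolP => // -[p0 _]; exact: measurable_ball_row.
apply/seteqP; split => x; last first.
  by move=> [p _]; rewrite /B; case: asboolP => // -[_ pU]; exact: pU.
move=> Ux; have /nbhs_ballP[e /= e0 eU] : nbhs x U by exact: open_nbhs_nbhs.
(* half of [e]: the ball of radius [r] around the rational centre below must
   still lie in the ball of radius [e] around [x] *)
have [r] := @rat_in_itvoo R 0 (e / 2) ltac:(by rewrite divr_gt0).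
rewrite in_itv /= => /andP[r0 re].
have H i : exists q : rat, x ord0 i - ratr r < ratr q < x ord0 i + ratr r.
  have [q] := @rat_in_itvoo R (x ord0 i - ratr r) (x ord0 i + ratr r)
    ltac:(by rewrite ltrBlDr -addrA ltrDl addr_gt0).
  by rewrite in_itv; exists q.
have [q qP] := choice H.
have xb : ball (map_mx (@ratr R) (\row_i q i)) (ratr r) x.
  split => // i j; rewrite !mxE ord1 /ball /= ltr_distl.
  exact: qP.
exists (\row_i q i, r); first by [].
rewrite /B; rewrite asboolT.
  exact: xb.
split; first exact: r0.
move=> y yb; apply: eU; rewrite [e]splitr.
apply: ball_triangle (_ : ball x (e/2) (map_mx ratr (\row_i q i))) _.
  by apply: (@le_ball _ _ _ (ratr r)); [exact: ltW | exact: ball_sym].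
by apply: (@le_ball _ _ _ (ratr r)); [exact: ltW |].
Qed.

Lemma open_continuous_measurable_row (Om : set 'rV[R]_n) (f : 'rV[R]_n -> R) :
  open Om -> (forall x, Om x -> {for x, continuous f}) -> measurable_fun Om f.
Proof.
move=> oOm cf; apply: (measurability (@RGenOpens.G R)).
  exact: RGenOpens.measurableE.
move=> _ [_ [a [b ->]] <-]; apply: open_measurable_row.
rewrite openE => x [Omx fx]; apply: filterI.
  exact: open_nbhs_nbhs.
by apply: (cf x Omx); apply: open_nbhs_nbhs; split=> //; exact: interval_open.
Qed.

Lemma continuous_measurable_row (f : 'rV[R]_n -> R) :
  continuous f -> measurable_fun setT f.
Proof.
move=> cf; apply: open_continuous_measurable_row => [|x _]; first exact: openT.
exact: cf.
Qed.

End measurability.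

(** * Integration over slices *)

Section product_measure.
Context {R : realType}.

Definition box n (B : R) : set 'rV[R]_n := [set x | forall i, `|x ord0 i| <= B].

Lemma preimage_row_cons_box n (B : R) :
  @row_cons R n @^-1` (box n.+1 B) = `[- B, B]%classic `*` box n B.
Proof.
apply/seteqP; split => -[a x] /=.
  move=> H; split => [|i].
    have := H (@lshift 1 n ord0); rewrite /row_cons [X in `|X|]row_mxEl mxE /=.
    by rewrite in_itv /= ler_norml.
  by have := H (rshift 1 i); rewrite /row_cons [X in `|X|]row_mxEr.
rewrite in_itv /= => -[aB xB] i.
have [j ->|j ->] := @split_ordP 1 n i.
  by rewrite /row_cons [X in `|X|]row_mxEl mxE /= ler_norml.
by rewrite /row_cons [X in `|X|]row_mxEr; exact: xB.
Qed.

Lemma compact_box n (B : R) : compact (box n B).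
Proof.
rewrite (_ : box n B = [set v | forall i, `[- B, B]%classic (v ord0 i)]).
  by apply: (@rV_compact _ n (fun=> `[- B, B]%classic)) => i; exact: segment_compact.
by apply/seteqP; split => x xB i; have := xB i; rewrite /= in_itv /= ler_norml.
Qed.

Lemma measurable_box n (B : R) : measurable (box n B).
Proof.
rewrite -[X in measurable X]setCK; apply: measurableC.
apply: open_measurable_row; rewrite openC.
apply: compact_closed; last exact: compact_box.
exact: norm_hausdorff.
Qed.

Lemma lebesgue_row_box n (B : R) : (lebesgue_row n (box n B) < +oo)%E.
Proof.
elim: n => [|n IH].
  by rewrite /= /dirac /= indicE ltry.
change ((pushforward (lebesgue_measure \x lebesgue_row n) (@row_cons R n))
  (box n.+1 B) < +oo)%E.
rewrite /pushforward preimage_row_cons_box product_measure1E //=; last exact: measurable_box.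
rewrite lte_mul_pinfty // ?ge0_fin_numE//.
by rewrite lebesgue_measure_itv /=; case: ifP => _ //; rewrite -EFinB ltry.
Qed.

Definition supported_in_box n (B : R) (f : 'rV[R]_n -> R) :=
  forall x, f x != 0 -> box n B x.

(** A continuous function supported in a box is dominated by a multiple of the
    indicator of the box. *)
Lemma integrable_row n (f : 'rV[R]_n -> R) (B : R) :
  continuous f -> supported_in_box n B f ->
  (lebesgue_row n).-integrable setT (EFin \o f).
Proof.
move=> cf sf.
have /compact_bounded[M [_ /(_ (`|M| + 1)) Mb]] : compact (f @` box n B).
  apply: continuous_compact; last exact: compact_box.
  exact: continuous_subspaceT.
have {}Mb x : box n B x -> `|f x| <= `|M| + 1.
  move=> xB; apply: Mb; last by exists x.
  by rewrite (le_lt_trans (ler_norm _)) // ltrDl.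
apply: (@le_integrable _ _ _ _ _ _ _
    (fun x => ((`|M| + 1)%:E * (\1_(box n B) x)%:E)%E)) => //.
- by apply/measurable_EFinP; exact: continuous_measurable_row.
- move=> x _ /=; rewrite lee_fin.
  have [->|fx0] := eqVneq (f x) 0; first by rewrite normr0.
  have xB := sf _ fx0.
  by rewrite indicE mem_set // mulr1 (le_trans (Mb _ xB)) // ler_norm.
- apply: integrableZl => //.
  apply/integrableP; split.
    by apply/measurable_EFinP; apply: measurable_indic; exact: measurable_box.
  rewrite (eq_integral (fun x => (\1_(box n B) x)%:E)).
    by rewrite integral_indic ?setIT //; [exact: lebesgue_row_box | exact: measurable_box].
  by move=> x _; rewrite /= ger0_norm.
Qed.

Lemma measurable_comp_row_cons n (f : 'rV[R]_n.+1 -> R) :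
  measurable_fun setT f ->
  measurable_fun setT ((EFin \o f) \o @row_cons R n).
Proof.
move=> mf; apply: measurableT_comp; last exact: measurable_row_cons.
exact/measurable_EFinP.
Qed.

Lemma integrable_comp_row_cons n (f : 'rV[R]_n.+1 -> R) :
  measurable_fun setT f ->
  (lebesgue_row n.+1).-integrable setT (EFin \o f) ->
  (lebesgue_measure \x lebesgue_row n)%E.-integrable setT
    ((EFin \o f) \o @row_cons R n).
Proof.
move=> mf /integrableP[_ intf]; apply/integrableP; split.
  exact: measurable_comp_row_cons.
apply: le_lt_trans intf.
change (lebesgue_row n.+1 : set _ -> \bar R) with
  (pushforward (lebesgue_measure \x lebesgue_row n)%E (@row_cons R n)).
rewrite [leRHS]ge0_integral_pushforward//.
  exact: measurable_row_cons.
by apply: measurableT_comp => //; exact/measurable_EFinP.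
Qed.

Lemma integral_row_cons n (f : 'rV[R]_n.+1 -> R) :
  measurable_fun setT f ->
  (lebesgue_row n.+1).-integrable setT (EFin \o f) ->
  (\int[lebesgue_row n.+1]_x (f x)%:E =
   \int[lebesgue_measure \x lebesgue_row n]_p (f (row_cons p))%:E)%E.
Proof.
move=> mf intf.
change (lebesgue_row n.+1 : set _ -> \bar R) with
  (pushforward (lebesgue_measure \x lebesgue_row n)%E (@row_cons R n)).
rewrite [LHS](@integral_pushforward _ _ _ _ _ _ (@measurable_row_cons R n)) //.
  exact/measurable_EFinP.
exact: integrable_comp_row_cons.
Qed.

(** Fubini's theorem in the two orders: according to the direction of the
    partial derivative to be integrated, the first variable has to be the inner
    or the outer one. *)
Lemma integral_first_inner n (f : 'rV[R]_n.+1 -> R) :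
  measurable_fun setT f ->
  (lebesgue_row n.+1).-integrable setT (EFin \o f) ->
  (\int[lebesgue_row n.+1]_x (f x)%:E =
   \int[lebesgue_row n]_y \int[lebesgue_measure]_a (f (row_cons (a, y)))%:E)%E.
Proof.
move=> mf intf; rewrite integral_row_cons //.
by rewrite -integral21_prod_meas1 //; exact: integrable_comp_row_cons.
Qed.

Lemma integral_first_outer n (f : 'rV[R]_n.+1 -> R) :
  measurable_fun setT f ->
  (lebesgue_row n.+1).-integrable setT (EFin \o f) ->
  (\int[lebesgue_row n.+1]_x (f x)%:E =
   \int[lebesgue_measure]_a \int[lebesgue_row n]_y (f (row_cons (a, y)))%:E)%E.
Proof.
move=> mf intf; rewrite integral_row_cons //.
by rewrite -integral12_prod_meas1 //; exact: integrable_comp_row_cons.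
Qed.

End product_measure.

(** * The integral of a partial derivative vanishes *)

Section divergence.
Context {R : realType}.

(** A directional derivative only sees the restriction to a line, so it is
    preserved by any [c] mapping the line at [x] in direction [v] to the line at
    [c x] in direction [w]; [c] itself may be affine on that line only. *)
Lemma is_derive_affine (V W : normedModType R) (c : V -> W) (f : W -> R)
    (x v : V) (w : W) (d : R) :
  (forall h : R, c (h *: v + x) = h *: w + c x) ->
  is_derive (c x) w f d -> is_derive x v (f \o c) d.
Proof.
move=> cE [df <-].
have E : (fun h : R => h^-1 *: (((f \o c) \o shift x) (h *: v) - (f \o c) x)) =
         (fun h : R => h^-1 *: ((f \o shift (c x)) (h *: w) - f (c x))).
  by apply/funext => h /=; rewrite cE.
apply: DeriveDef; first by rewrite /derivable E.
by rewrite /derive E.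
Qed.

Lemma row_cons_line_first n (a h : R) (y : 'rV[R]_n) :
  row_cons (h *: 1 + a, y) =
  h *: delta_mx ord0 (@lshift 1 n ord0) + row_cons (a, y).
Proof.
apply/rowP => k; have [j ->|j ->] := @split_ordP 1 n k.
  rewrite [LHS]row_mxEl [RHS]mxE [X in _ = _ + X]row_mxEl !mxE /=.
  by rewrite (ord1 j) eqxx.
by rewrite [LHS]row_mxEr [RHS]mxE [X in _ = _ + X]row_mxEr !mxE mulr0 add0r.
Qed.

Lemma row_cons_line_last n (a h : R) (y : 'rV[R]_n) (i : 'I_n) :
  row_cons (a, h *: delta_mx ord0 i + y) =
  h *: delta_mx ord0 (@rshift 1 n i) + row_cons (a, y).
Proof.
apply/rowP => k; have [j ->|j ->] := @split_ordP 1 n k.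
  by rewrite [LHS]row_mxEl [RHS]mxE [X in _ = _ + X]row_mxEl !mxE /= (ord1 j) mulr0 add0r.
by rewrite [LHS]row_mxEr [RHS]mxE [X in _ = _ + X]row_mxEr !mxE /= eq_rshift.
Qed.

(** Both topologies are products, so neighbourhoods are compared coordinate by
    coordinate. *)
Lemma continuous_row_cons n : continuous (@row_cons R n).
Proof.
move=> [a y] A [P Px PA].
exists ([set b | P ord0 (@lshift 1 n ord0) b],
        [set z : 'rV[R]_n | forall i, P ord0 (@rshift 1 n i) (z ord0 i)]) => /=.
  split.
    have := Px ord0 (@lshift 1 n ord0).
    by rewrite /row_cons [X in nbhs X]row_mxEl mxE.
  exists (fun _ i => P ord0 (@rshift 1 n i)) => [j i|z zP i]; last exact: zP.
  have := Px ord0 (@rshift 1 n i).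
  by rewrite (ord1 j) /row_cons [X in nbhs X]row_mxEr.
move=> [b z] /= [Pb Pz]; apply: PA => j k; rewrite (ord1 j).
have [l ->|l ->] := @split_ordP 1 n k.
  by rewrite (ord1 l) [X in P _ _ X]row_mxEl mxE.
by rewrite [X in P _ _ X]row_mxEr; exact: Pz.
Qed.

Lemma continuous_row_cons_first n (y : 'rV[R]_n) :
  continuous (fun a : R => row_cons (a, y)).
Proof.
move=> a; apply: (@continuous_comp _ _ _ (fun a : R => (a, y)) (@row_cons R n)).
  by apply: (@cvg_pair _ _ _ (nbhs a) (nbhs a) (nbhs y) _ _ _ id (fun=> y));
    [exact: cvg_id | exact: cvg_cst].
exact: continuous_row_cons.
Qed.

Lemma continuous_row_cons_last n (a : R) :
  continuous (fun y : 'rV[R]_n => row_cons (a, y)).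
Proof.
move=> y; apply: (@continuous_comp _ _ _ (fun y : 'rV[R]_n => (a, y)) (@row_cons R n)).
  by apply: (@cvg_pair _ _ _ (nbhs y) (nbhs a) (nbhs y) _ _ _ (fun=> a) id);
    [exact: cvg_cst | exact: cvg_id].
exact: continuous_row_cons.
Qed.

Lemma integral_derive_eq0 (f g : R -> R) (B : R) :
  continuous g -> (forall x : R, is_derive x 1 f (g x)) ->
  (forall x, B < `|x| -> f x = 0) -> (forall x, B < `|x| -> g x = 0) ->
  (\int[lebesgue_measure]_x (g x)%:E = 0)%E.
Proof.
(* an endpoint strictly larger than [B], where [f] is known to vanish *)
move=> cg dfg f0 g0; set b : R := `|B| + 1.
have b0 : 0 < b by rewrite ltr_wpDl.
have Bb : B < b by rewrite (le_lt_trans (ler_norm _)) // ltrDl.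
rewrite (_ : \int[_]_x _ = \int[lebesgue_measure]_(x in `[(- b)%R, b]%classic) (g x)%:E)%E; last first.
  rewrite [RHS]integral_mkcond; apply: eq_integral => x _.
  rewrite patchE; case: ifPn => // /negP; rewrite inE /= in_itv /= => /negP xb.
  rewrite g0 // (lt_trans Bb) // ltNge.
  by apply: contra xb; rewrite ler_norml.
rewrite (@continuous_FTC2 _ g f).
- by rewrite !f0 ?subee // ?normrN gtr0_norm.
- by rewrite gtrN.
- exact: continuous_subspaceT.
- have df x : derivable f x 1 by have [] := dfg x.
  have cf x : {for x, continuous f}.
    by apply: differentiable_continuous; rewrite -derivable1_diffP.
  split; first by move=> x _; exact: df.
  + by apply: cvg_at_right_filter; exact: cf.
  + by apply: cvg_at_left_filter; exact: cf.
- by move=> x _; rewrite derive1E; have [_ ->] := dfg x.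
Qed.

(** Induction on the dimension. If the derivative is in the first direction,
    integrate first along that direction, where the fundamental theorem of
    calculus gives zero; otherwise freeze the first variable and apply the
    induction hypothesis to the slice. *)
Lemma integral_partial_eq0 n (i : 'I_n) (f g : 'rV[R]_n -> R) (B : R) :
  continuous g -> (forall x, is_derive x (delta_mx ord0 i : 'rV[R]_n) f (g x)) ->
  supported_in_box n B f -> supported_in_box n B g ->
  (\int[lebesgue_row n]_x (g x)%:E = 0)%E.
Proof.
elim: n i f g => [[]//|n IH] i f g cg dfg sf sg.
have mg : measurable_fun setT g by exact: continuous_measurable_row.
have ig := integrable_row _ _ _ cg sg.
have out (h : 'rV[R]_n.+1 -> R) a y : supported_in_box n.+1 B h -> B < `|a| ->
    h (row_cons (a, y)) = 0.
  move=> sh Ba; apply/eqP; apply: contraTT Ba => /sh xB; rewrite -leNgt.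
  have : (@row_cons R n @^-1` (box n.+1 B)) (a, y) by [].
  by rewrite preimage_row_cons_box => -[]; rewrite /= in_itv /= ler_norml.
move: dfg; have [k -> dfg|k -> dfg] := @split_ordP 1 n i.
  rewrite integral_first_inner // integral0_eq // => y _.
  apply: (@integral_derive_eq0 (fun a => f (row_cons (a, y))) _ B).
  - move=> a; apply: (@continuous_comp _ _ _ (fun a : R => row_cons (a, y)) g).
      exact: continuous_row_cons_first.
    exact: cg.
  - move=> a; have := @is_derive_affine _ _ (fun a : R => row_cons (a, y)) f a 1
      _ _ _ (dfg (row_cons (a, y))); apply.
    by move=> h; rewrite row_cons_line_first (ord1 k).
  - by move=> a; exact: out.
  - by move=> a; exact: out.
rewrite integral_first_outer // integral0_eq // => a _.
have sub (h : 'rV[R]_n.+1 -> R) : supported_in_box n.+1 B h ->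
    supported_in_box n B (fun y => h (row_cons (a, y))).
  move=> sh y /sh xB.
  have : (@row_cons R n @^-1` (box n.+1 B)) (a, y) by [].
  by rewrite preimage_row_cons_box => -[].
apply: (IH k (fun y => f (row_cons (a, y))) (fun y => g (row_cons (a, y)))).
- move=> y; apply: (@continuous_comp _ _ _ (fun y : 'rV[R]_n => row_cons (a, y)) g).
    exact: continuous_row_cons_last.
  exact: cg.
- move=> y; have := @is_derive_affine _ _ (fun y : 'rV[R]_n => row_cons (a, y)) f y
    (delta_mx ord0 k) _ _ _ (dfg (row_cons (a, y))); apply.
  by move=> h; exact: row_cons_line_last.
- exact: sub.
- exact: sub.
Qed.

End divergence.

(** * Hardy inequalities from vector fields, for test functions *)

Section test_functions.
Context {R : realType} {n : nat}.
Local Notation e_ i := (delta_mx ord0 i : 'rV[R]_n).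
Local Notation leb := (lebesgue_row n).
Implicit Types (Om : set 'rV[R]_n) (phi : 'rV[R]_n -> R).

Definition sqnorm (x : 'rV[R]_n) : R := \sum_i x ord0 i ^+ 2.

Lemma enorm_sqr (x : 'rV[R]_n) : enorm x ^+ 2 = sqnorm x.
Proof. by rewrite sqr_sqrtr // sumr_ge0 // => i _; exact: sqr_ge0. Qed.

Lemma continuous_sum (T : topologicalType) (I : Type) (s : seq I)
    (f : I -> T -> R) (x : T) :
  (forall i, {for x, continuous (f i)}) ->
  {for x, continuous (fun y => \sum_(i <- s) f i y)}.
Proof.
move=> cf; elim: s => [|i s IH].
  rewrite (_ : (fun y => _) = cst 0); first exact: cvg_cst.
  by apply/funext => y; rewrite big_nil.
rewrite (_ : (fun y => _) = (fun y => f i y + \sum_(j <- s) f j y)).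
  exact: (cvgD (cf i) IH).
by apply/funext => y; rewrite big_cons.
Qed.

Lemma test_function_continuous Om phi : test_function Om phi -> continuous phi.
Proof. by move=> [sphi _ _]; have [] := sphi [::]. Qed.

Lemma test_function_partial_continuous Om phi i :
  test_function Om phi -> continuous (partial i phi).
Proof. by move=> [sphi _ _]; have [] := sphi [:: i]. Qed.

Lemma test_function_is_derive Om phi i x : test_function Om phi ->
  is_derive x (e_ i) phi (partial i phi x).
Proof. by move=> [sphi _ _]; apply: derivableP; have [_] := sphi [::]; exact. Qed.

Lemma near0_out_closure phi x : ~ closure [set y | phi y != 0] x ->
  \forall y \near x, phi y = 0.
Proof.
move=> xS; have : nbhs x (~` closure [set y | phi y != 0]).
  by apply: open_nbhs_nbhs; split=> //; rewrite openC; exact: closed_closure.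
apply: filterS => y yS; apply/eqP; apply: contra_notT yS => phiy.
exact: subset_closure.
Qed.

Lemma test_function_near0 Om phi x : test_function Om phi -> ~ Om x ->
  \forall y \near x, phi y = 0.
Proof.
by move=> [_ _ sOm] nOm; apply: near0_out_closure => /sOm.
Qed.

Lemma test_function_eq0 Om phi x : test_function Om phi -> ~ Om x -> phi x = 0.
Proof. by move=> tphi /(test_function_near0 _ _ _ tphi)/nbhs_singleton. Qed.

Lemma test_function_partial_eq0 Om phi i x : test_function Om phi -> ~ Om x ->
  partial i phi x = 0.
Proof.
move=> tphi /(test_function_near0 _ _ _ tphi) phi0.
by rewrite /partial (near_eq_derive _ phi0) derive_cst.
Qed.

Lemma norm_coord_le (x : 'rV[R]_n) i : `|x ord0 i| <= `|x|.
Proof.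
rewrite [leRHS]mx_normrE.
exact: (@le_bigmax _ _ _ 0 (fun ij : 'I_1 * 'I_n => `|x ij.1 ij.2|) (ord0, i)).
Qed.

Lemma test_function_box Om phi : test_function Om phi ->
  exists B : R, supported_in_box n B phi /\
    forall i, supported_in_box n B (partial i phi).
Proof.
move=> [sphi + _] => /compact_bounded[M [_ /(_ (`|M| + 1)) Mb]].
have bd x : closure [set x | phi x != 0] x -> box n (`|M| + 1) x.
  move=> Sx i; apply: le_trans (norm_coord_le x i) _; apply: Mb => //.
  by rewrite (le_lt_trans (ler_norm _)) // ltrDl.
exists (`|M| + 1); split=> [x phix|i x pphix].
  by apply: bd; exact: subset_closure.
apply: bd; apply: contrapT => nS; move/eqP: pphix; apply.
have phi0 := near0_out_closure _ _ nS.
by rewrite /partial (near_eq_derive _ phi0) derive_cst.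
Qed.

(** Here [g] is the [i]-th partial derivative of [phi^2 F]. The function [F] is
    only regular inside [Om] (the field used below is singular at the origin and
    on the hyperplane bounding the half space), but [phi] vanishes near every
    point outside [Om], so [phi^2 F] and [g] extend by zero without loss of
    regularity. The factor [phi] in front of [g] makes this extension
    automatic. *)
Lemma integral_div_eq0 Om phi (F D : 'rV[R]_n -> R) i :
  open Om -> test_function Om phi ->
  (forall x, Om x -> is_derive x (e_ i) F (D x)) ->
  (forall x, Om x -> {for x, continuous F}) ->
  (forall x, Om x -> {for x, continuous D}) ->
  let g x := phi x * (2 * partial i phi x * F x + phi x * D x) in
  leb.-integrable setT (EFin \o g) /\ (\int[leb]_x (g x)%:E = 0)%E.
Proof.
move=> oOm tphi dF cF cD g.
have cphi := test_function_continuous _ _ tphi.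
have cpphi := test_function_partial_continuous _ _ i tphi.
have [B [sphi spphi]] := test_function_box _ _ tphi.
have sg : supported_in_box n B g.
  by move=> x gx; apply: sphi; apply: contra_neq gx; rewrite /g => ->; rewrite mul0r.
have sphiF : supported_in_box n B (phi * phi * F).
  move=> x gx; apply: sphi; apply: contra_neq gx => phix.
  by rewrite [LHS](_ : _ = phi x * phi x * F x) // phix !mul0r.
have cg : continuous g.
  move=> x; have [Omx|nOmx] := pselect (Om x).
    exact: (cvgM (cphi x) (cvgD (cvgM (cvgM (cvg_cst (2 : R)) (cpphi x))
      (cF _ Omx)) (cvgM (cphi x) (cD _ Omx)))).
  have g0 : \forall y \near x, g y = 0.
    by apply: filterS (test_function_near0 _ _ _ tphi nOmx) => y;
      rewrite /g => ->; rewrite mul0r.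
  rewrite /continuous_at (nbhs_singleton g0); exact: (cvg_near_cst 0 g0).
split; first exact: (integrable_row _ _ _ cg sg).
apply: (integral_partial_eq0 _ i _ _ _ cg _ sphiF sg) => x.
have [Omx|nOmx] := pselect (Om x).
  have dphi := test_function_is_derive _ _ i x tphi.
  apply: (is_derive_eq (is_deriveM (is_deriveM dphi dphi) (dF _ Omx))).
  rewrite /g [(phi * phi) x](_ : _ = phi x * phi x) //.
  rewrite /GRing.scale /=; ring.
rewrite /g (test_function_eq0 _ _ _ tphi nOmx) mul0r.
apply: (@near_eq_is_derive _ _ _ (cst 0)).
apply: filterS (test_function_near0 _ _ _ tphi nOmx) => y phiy.
by rewrite [RHS](_ : _ = phi y * phi y * F y) // phiy !mul0r.
Qed.

(** Pointwise,
    [|grad phi|^2 - (- div F - |F|^2) phi^2 - div (phi^2 F)] is the square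
    [|grad phi - phi F|^2], and the divergence integrates to zero. *)
Lemma hardy_vector_field Om (F D : 'I_n -> 'rV[R]_n -> R)
    (V : 'rV[R]_n -> R) phi :
  open Om ->
  (forall i x, Om x -> is_derive x (e_ i) (F i) (D i x)) ->
  (forall i x, Om x -> {for x, continuous (F i)}) ->
  (forall i x, Om x -> {for x, continuous (D i)}) ->
  measurable_fun Om V ->
  (forall x, Om x -> 0 <= V x) ->
  (forall x, Om x -> V x <= - \sum_i D i x - \sum_i F i x ^+ 2) ->
  test_function Om phi ->
  (\int[leb]_(x in Om) (V x * phi x ^+ 2)%:E <=
   \int[leb]_(x in Om) (enorm (grad phi x) ^+ 2)%:E)%E.
Proof.
move=> oOm dF cF cD mV V0 VF tphi.
have mOm : measurable Om by exact: open_measurable_row.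
have cphi := test_function_continuous _ _ tphi.
have cpphi i := test_function_partial_continuous _ _ i tphi.
have [B [sphi spphi]] := test_function_box _ _ tphi.
pose g i x := phi x * (2 * partial i phi x * F i x + phi x * D i x).
have gP i := integral_div_eq0 _ _ _ _ i oOm tphi (dF i) (cF i) (cD i).
pose N x := \sum_i partial i phi x ^+ 2.
have cN : continuous N.
  move=> x; apply: continuous_sum => i.
  exact: (cvgM (cpphi i x) (cpphi i x)).
have NE x : enorm (grad phi x) ^+ 2 = N x.
  by rewrite enorm_sqr /sqnorm; apply: eq_bigr => i _; rewrite mxE.
have sN : supported_in_box n B N.
  move=> x; apply: contra_neqP => xB; rewrite /N big1 // => i _.
  have [->|/spphi//] := eqVneq (partial i phi x) 0.
  by rewrite expr0n.
have iN := integrable_row _ _ _ cN sN.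
have iG : leb.-integrable setT (fun x => \sum_i (g i x)%:E)%E.
  by apply: integrable_sum => // i _; exact: (gP i).1.
have G0 : (\int[leb]_x (\sum_i (g i x)%:E) = 0)%E.
  rewrite integral_sum //; last by move=> i; exact: (gP i).1.
  by rewrite big1 // => i _; exact: (gP i).2.
have H : (\int[leb]_(x in Om) (V x * phi x ^+ 2)%:E <=
    \int[leb]_(x in Om) ((N x)%:E - \sum_i (g i x)%:E))%E.
  apply: ge0_le_integral => //.
  - by move=> x Omx; rewrite lee_fin mulr_ge0 ?sqr_ge0 ?V0.
  - apply/measurable_EFinP; apply: measurable_funM => //.
    apply: measurable_funX; apply: measurable_funTS.
    exact: continuous_measurable_row.
  - apply: measurable_funTS; apply: emeasurable_funB.
      by case/integrableP: iN.
    by case/integrableP: iG.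
  move=> x Omx; rewrite sumEFin -EFinB lee_fin.
  apply: (@le_trans _ _ ((- \sum_i D i x - \sum_i F i x ^+ 2) * phi x ^+ 2)).
    by rewrite ler_wpM2r ?sqr_ge0 ?VF.
  rewrite -opprD -big_split /= mulNr mulr_suml /N -sumrB -subr_ge0 opprK -big_split /=.
  apply: sumr_ge0 => i _; rewrite /g.
  rewrite [leRHS](_ : _ = (partial i phi x - phi x * F i x) ^+ 2) ?sqr_ge0 //.
  ring.
apply: le_trans H _.
under [leRHS]eq_integral do rewrite NE.
have out (h : 'rV[R]_n -> \bar R) : (forall x, ~ Om x -> h x = 0%E) ->
    (\int[leb]_(x in Om) h x = \int[leb]_x h x)%E.
  move=> h0; rewrite integral_mkcond; apply: eq_integral => x _.
  rewrite patchE; case: ifPn => // /negP xOm; rewrite h0 // => Omx.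
  by apply: xOm; rewrite inE.
have N0 x : ~ Om x -> N x = 0.
  move=> nOm; rewrite /N big1 // => i _.
  by rewrite (test_function_partial_eq0 _ _ _ _ tphi nOm) expr0n.
rewrite !out //.
- by rewrite integralB // G0 sube0.
- by move=> x /N0 ->.
- move=> x nOm; rewrite N0 // sumEFin big1 ?subee // => i _.
  by rewrite /g (test_function_eq0 _ _ _ tphi nOm) mul0r.
Qed.

End test_functions.

(** * Passing to the closure of the test functions *)

Section density.
Context {R : realType} {n : nat}.
Local Notation leb := (lebesgue_row n).

Lemma integral_le_comb d (T : measurableType d) (mu : {measure set T -> \bar R})
    (D : set T) (A B C : T -> R) (b c : R) :
  measurable D -> measurable_fun D A -> measurable_fun D B ->
  measurable_fun D C -> 0 <= b -> 0 <= c ->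
  (forall x, D x -> 0 <= A x) -> (forall x, D x -> 0 <= B x) ->
  (forall x, D x -> 0 <= C x) ->
  (forall x, D x -> A x <= b * B x + c * C x) ->
  (\int[mu]_(x in D) (A x)%:E <=
   b%:E * \int[mu]_(x in D) (B x)%:E + c%:E * \int[mu]_(x in D) (C x)%:E)%E.
Proof.
move=> mD mA mB mC b0 c0 A0 B0 C0 ABC.
have mB' : measurable_fun D (EFin \o B) by exact/measurable_EFinP.
have mC' : measurable_fun D (EFin \o C) by exact/measurable_EFinP.
rewrite -!ge0_integralZl_EFin //; try by move=> x Dx; rewrite lee_fin; auto.
rewrite -ge0_integralD //.
- apply: ge0_le_integral => //.
  + exact/measurable_EFinP.
  + by apply: emeasurable_funD; exact: measurable_funeM.
- by move=> x Dx; rewrite -[X in (_ <= X)%E]EFinM lee_fin mulr_ge0 //; auto.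
- exact: measurable_funeM.
- by move=> x Dx; rewrite -[X in (_ <= X)%E]EFinM lee_fin mulr_ge0 //; auto.
- exact: measurable_funeM.
Qed.

(** The triangle inequality in squared form. The difference of the two sides is
    [e (b - (a - b) / e)^2]. *)
Lemma sqr_le_young (a b e : R) : 0 < e ->
  a ^+ 2 <= (1 + e) * b ^+ 2 + (1 + e^-1) * (a - b) ^+ 2.
Proof.
move=> e0; rewrite -subr_ge0.
rewrite [leRHS](_ : _ = e * (b - e^-1 * (a - b)) ^+ 2); last by field; rewrite gt_eqF.
by rewrite mulr_ge0 ?sqr_ge0 // ltW.
Qed.

Lemma enorm_le_young (x y : 'rV[R]_n) (e : R) : 0 < e ->
  enorm x ^+ 2 <= (1 + e) * enorm y ^+ 2 + (1 + e^-1) * enorm (y - x) ^+ 2.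
Proof.
move=> e0; rewrite !enorm_sqr /sqnorm !mulr_sumr -big_split /=; apply: ler_sum => i _.
by rewrite !mxE -[(y _ _ - _) ^+ 2]sqrrN opprB sqr_le_young.
Qed.

Lemma measurable_enorm_sqr (D : set 'rV[R]_n) (g : 'rV[R]_n -> 'rV[R]_n) :
  (forall i, measurable_fun D (fun x => g x ord0 i)) ->
  measurable_fun D (fun x => enorm (g x) ^+ 2).
Proof.
move=> mg; under eq_fun do rewrite enorm_sqr.
by rewrite /sqnorm; apply: measurable_sum => i; exact: measurable_funX.
Qed.

(** The left-hand side is the bound obtained in [hardy_bounded_weight] when the
    approximation is at squared distance [d]: first [t] makes [(1 + t)^2 G] close
    to [G], then [d] absorbs the terms that contain [t^-1]. *)
Lemma small_parameters (G K e : R) : 0 <= G -> 0 <= K -> 0 < e ->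
  exists t d : R, [/\ 0 < t, 0 < d &
    (1 + t) * ((1 + t) * G + (1 + t^-1) * d) + (1 + t^-1) * K * d <= G + e].
Proof.
move=> G0 K0 e0; pose t := e / (6 * (G + 1) + e).
have den : 0 < 6 * (G + 1) + e by lra.
have t0 : 0 < t by rewrite divr_gt0.
have tE : t * (6 * (G + 1) + e) = e by rewrite mulfVK // gt_eqF.
pose C := (1 + t) * (1 + t^-1) + (1 + t^-1) * K.
have ti : 0 < t^-1 by rewrite invr_gt0.
have C0 : 0 < C by rewrite ltr_wpDr ?mulr_ge0 ?mulr_gt0 //; lra.
exists t, (e / (2 * C)); split=> //; first by rewrite divr_gt0 // mulr_gt0.
set d := e / _.
have dE : C * d = e / 2 by rewrite /d; field; rewrite gt_eqF.
rewrite [leLHS](_ : _ = (1 + t) ^+ 2 * G + C * d); last by rewrite /C; ring.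
rewrite dE.
have t1 : t <= 1 by rewrite ler_pdivrMr // mul1r; lra.
have tG : 6 * (t * G) <= e by nra.
have ttG : t * (t * G) <= t * G by rewrite ler_piMl // mulr_ge0 // ltW.
nra.
Qed.

Lemma measurable_grad_coord (Om : set 'rV[R]_n) (phi : 'rV[R]_n -> R) D i :
  test_function Om phi -> measurable_fun D (fun x => grad phi x ord0 i).
Proof.
move=> tphi; apply: measurable_funTS.
rewrite (_ : (fun x => _) = partial i phi); last by apply/funext => x; rewrite mxE.
by apply: continuous_measurable_row; exact: test_function_partial_continuous tphi.
Qed.

(** For a weight bounded by [K], approximate [v] by a test function [phi]: the
    weighted integral of [v^2] is compared with that of [phi^2] at the cost of
    [K] times the squared distance, then [hardy] applies to [phi], and the
    Dirichlet integral of [phi] is compared with that of [v]. *)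
Lemma hardy_bounded_weight (Om : set 'rV[R]_n) (V : 'rV[R]_n -> R) (K : R)
    (v : 'rV[R]_n -> R) (g : 'rV[R]_n -> 'rV[R]_n) :
  open Om -> measurable_fun Om V ->
  (forall x, Om x -> 0 <= V x <= K) ->
  (forall phi, test_function Om phi ->
    (\int[leb]_(x in Om) (V x * phi x ^+ 2)%:E <=
     \int[leb]_(x in Om) (enorm (grad phi x) ^+ 2)%:E)%E) ->
  H10 Om v g ->
  (\int[leb]_(x in Om) (V x * v x ^+ 2)%:E <=
   \int[leb]_(x in Om) (enorm (g x) ^+ 2)%:E)%E.
Proof.
move=> oOm mV VK hardy [[[mv _] L2g _] dens].
have mOm : measurable Om by exact: open_measurable_row.
have mg i : measurable_fun Om (fun x => g x ord0 i) by have [] := L2g i.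
have K0 : 0 <= `|K| by [].
set I := (X in (_ <= X)%E).
have I0 : (0 <= I)%E by apply: integral_ge0 => x _; rewrite lee_fin sqr_ge0.
have [->|Ifin] := eqVneq I +oo%E; first by rewrite leey.
have {Ifin} Ifin : I \is a fin_num by rewrite ge0_fin_numE // ltey.
rewrite -(fineK Ifin); set G := fine I.
have G0 : 0 <= G by exact: fine_ge0.
apply/lee_addgt0Pr => e e0.
have [t [d [t0 d0 tdG]]] := small_parameters _ _ _ G0 K0 e0.
have t1 : 0 <= 1 + t by lra.
have ti : 0 < t^-1 by rewrite invr_gt0.
have ti1 : 0 <= 1 + t^-1 by lra.
have [phi tphi] := dens _ d0; rewrite /H1_sqnorm.
set J1 := (\int[_]_(_ in _) _)%E; set J2 := (\int[_]_(_ in _) _)%E => Jd.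
have J1d : (J1 <= d%:E)%E.
  apply: le_trans (ltW Jd); rewrite leeDl // integral_ge0 // => x _.
  by rewrite lee_fin sqr_ge0.
have J2d : (J2 <= d%:E)%E.
  apply: le_trans (ltW Jd); rewrite leeDr // integral_ge0 // => x _.
  by rewrite lee_fin sqr_ge0.
have mphi : measurable_fun Om phi.
  apply: measurable_funTS; apply: continuous_measurable_row.
  exact: test_function_continuous tphi.
have mgrad i := measurable_grad_coord _ _ Om i tphi.
have step1 : (\int[leb]_(x in Om) (V x * v x ^+ 2)%:E <=
    (1 + t)%:E * \int[leb]_(x in Om) (V x * phi x ^+ 2)%:E +
    ((1 + t^-1) * `|K|)%:E * J1)%E.
  apply: integral_le_comb => //.
  - by apply: measurable_funM => //; exact: measurable_funX.
  - by apply: measurable_funM => //; exact: measurable_funX.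
  - by apply: measurable_funX; exact: measurable_funB.
  - by rewrite mulr_ge0.
  - by move=> x /VK/andP[V0 _]; rewrite mulr_ge0 ?sqr_ge0.
  - by move=> x /VK/andP[V0 _]; rewrite mulr_ge0 ?sqr_ge0.
  - by move=> x _; rewrite sqr_ge0.
  - move=> x /VK/andP[V0 VK'] /=.
    apply: (@le_trans _ _
      (V x * ((1 + t) * phi x ^+ 2 + (1 + t^-1) * (v x - phi x) ^+ 2))).
      by rewrite ler_wpM2l // sqr_le_young.
    rewrite mulrDr lerD //; first by rewrite mulrCA.
    rewrite mulrCA -mulrA ler_wpM2l // ler_wpM2r ?sqr_ge0 //.
    by rewrite (le_trans VK') // ler_norm.
have step2 : (\int[leb]_(x in Om) (enorm (grad phi x) ^+ 2)%:E <=
    (1 + t)%:E * I + (1 + t^-1)%:E * J2)%E.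
  apply: integral_le_comb => //.
  - exact: measurable_enorm_sqr.
  - exact: measurable_enorm_sqr.
  - apply: measurable_enorm_sqr => i.
    rewrite (_ : (fun x => _) = (fun x => g x ord0 i - grad phi x ord0 i)).
      exact: measurable_funB.
    by apply/funext => x; rewrite !mxE.
  - by move=> x _; rewrite sqr_ge0.
  - by move=> x _; rewrite sqr_ge0.
  - by move=> x _; rewrite sqr_ge0.
  - by move=> x _; exact: enorm_le_young.
apply: (le_trans step1).
apply: (@le_trans _ _ ((1 + t)%:E * ((1 + t)%:E * I + (1 + t^-1)%:E * d%:E)
    + ((1 + t^-1) * `|K|)%:E * d%:E)%E).
  apply: leeD; last by rewrite lee_wpmul2l // lee_fin mulr_ge0.
  rewrite lee_wpmul2l ?lee_fin //; apply: (le_trans (hardy _ tphi)).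
  apply: (le_trans step2); apply: leeD => //.
  by rewrite lee_wpmul2l ?lee_fin.
by rewrite -(fineK Ifin) -/G; rewrite -lee_fin in tdG; exact: tdG.
Qed.

(** The weight may be unbounded near the boundary, so the two sides are not
    obviously continuous in [v]. Truncating it at height [k] reduces to
    bounded weights; the truncations increase to [V]. *)
Lemma hardy_closure (Om : set 'rV[R]_n) (V : 'rV[R]_n -> R)
    (v : 'rV[R]_n -> R) (g : 'rV[R]_n -> 'rV[R]_n) :
  open Om -> measurable_fun Om V -> (forall x, Om x -> 0 <= V x) ->
  (forall phi, test_function Om phi ->
    (\int[leb]_(x in Om) (V x * phi x ^+ 2)%:E <=
     \int[leb]_(x in Om) (enorm (grad phi x) ^+ 2)%:E)%E) ->
  H10 Om v g ->
  (\int[leb]_(x in Om) (V x * v x ^+ 2)%:E <=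
   \int[leb]_(x in Om) (enorm (g x) ^+ 2)%:E)%E.
Proof.
move=> oOm mV V0 hardy hv.
have mOm : measurable Om by exact: open_measurable_row.
pose Vk (k : nat) x := Num.min (V x) k%:R.
have Vk0 k x : Om x -> 0 <= Vk k x.
  by move=> Omx; rewrite /Vk le_min V0 // ler0n.
have mVk k : measurable_fun Om (Vk k).
  by apply: measurable_minr => //; exact: measurable_cst.
have mv : measurable_fun Om v by have [[[]]] := hv.
have mVv k : measurable_fun Om (fun x => (Vk k x * v x ^+ 2)%:E).
  by apply/measurable_EFinP; apply: measurable_funM => //; exact: measurable_funX.
have Vkle k : (\int[leb]_(x in Om) (Vk k x * v x ^+ 2)%:E <=
    \int[leb]_(x in Om) (enorm (g x) ^+ 2)%:E)%E.
  apply: (hardy_bounded_weight _ (Vk k) k%:R) => //.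
    by move=> x Omx; rewrite Vk0 //= /Vk ge_min lexx orbT.
  move=> phi tphi; apply: le_trans (hardy _ tphi).
  have mphi : measurable_fun Om phi.
    apply: measurable_funTS; apply: continuous_measurable_row.
    exact: test_function_continuous tphi.
  apply: ge0_le_integral => //.
  - by move=> x Omx; rewrite lee_fin mulr_ge0 ?sqr_ge0 ?Vk0.
  - by apply/measurable_EFinP; apply: measurable_funM => //; exact: measurable_funX.
  - by apply/measurable_EFinP; apply: measurable_funM => //; exact: measurable_funX.
  - by move=> x Omx; rewrite lee_fin ler_wpM2r ?sqr_ge0 // /Vk ge_min lexx.
have nd x : Om x -> {homo (fun k => (Vk k x * v x ^+ 2)%:E) : k l / (k <= l)%N >-> (k <= l)%E}.
  move=> Omx k l kl; rewrite lee_fin ler_wpM2r ?sqr_ge0 // /Vk.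
  by rewrite le_min ge_min lexx /= ge_min ler_nat kl orbT.
have Vv0 k x : Om x -> (0 <= (Vk k x * v x ^+ 2)%:E)%E.
  by move=> Omx; rewrite lee_fin mulr_ge0 ?sqr_ge0 ?Vk0.
have cvg_int := @cvg_monotone_convergence _ _ _ leb _ mOm _ mVv Vv0 nd.
rewrite (eq_integral (fun x => limn (fun k => (Vk k x * v x ^+ 2)%:E))); last first.
  move=> x _; apply/esym/cvg_lim => //; apply: cvg_near_cst.
  exists (Num.bound `|V x|) => // k /= Nk; congr (_ * _)%:E; apply/min_idPl.
  rewrite (le_trans (ler_norm _)) // (le_trans (ltW (archi_boundP _))) ?normr_ge0//.
  by rewrite ler_nat.
rewrite -(cvg_lim _ cvg_int) //; apply: lime_le; last by exact: nearW.
by apply/cvg_ex; eexists; exact: cvg_int.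
Qed.

End density.

(** * The field of the ground state and its potential *)

Section ground_state.
Context {R : realType}.

(** The chain rule for a directional derivative followed by a function of one
    real variable, by restriction to the line in direction [v]. *)
Lemma is_derive_comp_row n (f : 'rV[R]_n -> R) (g : R -> R) (x v : 'rV[R]_n) (df dg : R) :
  is_derive x v f df -> is_derive (f x) 1 g dg ->
  is_derive x v (fun y => g (f y)) (dg * df).
Proof.
move=> [dfx <-] dgx.
have line (h : 'rV[R]_n -> R) : 'D_v h x = 'D_1 (fun t : R => h (t *: v + x)) 0.
  rewrite /derive; set g1 := fun t => t^-1 *: _; set g2 := fun t => t^-1 *: _.
  suff -> : g1 = g2 by [].
  by apply/funext => t; rewrite /g1 /g2 /= addr0 scale0r add0r [_%:A]mulr1.
have d1 : is_derive (0 : R) 1 (fun t : R => f (t *: v + x)) ('D_v f x).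
  by apply: DeriveDef; [exact: (derivable1P f x v).1 | rewrite line].
have d2 : is_derive ((fun t : R => f (t *: v + x)) 0) 1 g dg.
  by rewrite scale0r add0r.
have [d3 e3] := is_derive1_comp d2 d1.
apply: DeriveDef; first exact: (derivable1P (fun y => g (f y)) x v).2.
by rewrite line -e3.
Qed.

Lemma is_derive_coord n (i j : 'I_n) (x : 'rV[R]_n) :
  is_derive x (delta_mx ord0 i : 'rV[R]_n) (fun y : 'rV[R]_n => y ord0 j)
    (j == i)%:R.
Proof.
apply: (@is_derive_affine R _ _ (fun y : 'rV[R]_n => y ord0 j) id x _ (j == i)%:R).
by move=> h; rewrite !mxE eqxx.
Qed.

Lemma is_derive_sqnorm n (i : 'I_n) (x : 'rV[R]_n) :
  is_derive x (delta_mx ord0 i : 'rV[R]_n) (@sqnorm R n) (2 * x ord0 i).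
Proof.
rewrite (_ : @sqnorm R n = \sum_(j < n) (fun y : 'rV[R]_n => y ord0 j) ^+ 2); last first.
  by apply/funext => y; rewrite fct_sumE.
apply: (is_derive_eq (is_derive_sum (fun j => is_deriveX 2 (is_derive_coord n i j x)))).
rewrite (bigD1 i) //= eqxx big1 => [|j /negPf->].
  by rewrite addr0 /GRing.scale /= mulr1 expr1 mulr_natl.
by rewrite /GRing.scale /= mulr0.
Qed.

Lemma continuous_sqnorm n : continuous (@sqnorm R n).
Proof.
move=> x; apply: continuous_sum => i.
exact: (cvgM (@coord_continuous R 1 n ord0 i x) (@coord_continuous R 1 n ord0 i x)).
Qed.

Section radial_part.
Variables (N L : R).

(** [log (L / |x|)] as a function of [q = |x|^2]; see [logratio_enorm]. Working
    with [q] instead of [|x|] keeps square roots out of the derivatives. *)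
Definition logratio (q : R) : R := ln L - ln q / 2.
(** The radial factor [|x|^(-N/2) (log (L/|x|))^(1/2)] of the ground state has
    logarithmic gradient [- x * radial |x|^2]. *)
Definition radial (q : R) : R := (N / 2 + (2 * logratio q)^-1) / q.
Definition dradial (q : R) : R :=
  ((4 * logratio q ^+ 2)^-1 - N / 2 - (2 * logratio q)^-1) / q ^+ 2.
(** The weight of the inequality, as a function of [q = |x|^2]. *)
Definition potential (q : R) : R := (N ^+ 2 / 4 + (4 * logratio q ^+ 2)^-1) / q.

Lemma is_derive_logratio (q : R) : 0 < q -> is_derive q 1 logratio (- (2 * q)^-1).
Proof.
move=> q0.
have -> : logratio = cst (ln L) - (2^-1 : R) *: @ln R.
  by apply/funext => y; rewrite /logratio mulrC.
apply: (is_derive_eq (is_deriveB (is_derive_cst _ _ _) (is_deriveZ _ (is_derive1_ln q0)))).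
by rewrite /GRing.scale /= sub0r invfM.
Qed.

Lemma is_derive_radial (q : R) : 0 < q -> 0 < logratio q -> is_derive q 1 radial (dradial q).
Proof.
move=> q0 l0; have dl := is_derive_logratio _ q0.
have dli := is_deriveV (lt0r_neq0 l0) dl.
have dq := is_deriveV (lt0r_neq0 q0) (is_derive_id q (1 : R)).
have db := is_deriveD (is_derive_cst (N / 2 : R) q (1 : R)) (is_deriveZ (2^-1) dli).
rewrite (_ : radial = (cst (N / 2) + 2^-1 *: (fun y => (logratio y)^-1)) * (fun y => y^-1)).
  apply: (is_derive_eq (is_deriveM db dq)).
  rewrite [(cst _ + _) q](_ : _ = N / 2 + 2^-1 * (logratio q)^-1) //.
  rewrite /GRing.scale /= /dradial; field; rewrite ?gt_eqF //.
by apply/funext => y; rewrite /radial invfM.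
Qed.

Lemma continuous_logratio (q : R) : 0 < q -> {for q, continuous logratio}.
Proof.
move=> q0; have [dlog _] := is_derive_logratio _ q0.
by apply: differentiable_continuous; rewrite -derivable1_diffP.
Qed.

Lemma continuous_logratioV (q : R) : 0 < q -> 0 < logratio q ->
  {for q, continuous (fun y => (logratio y)^-1)}.
Proof. by move=> q0 l0; apply: continuousV; [exact: lt0r_neq0 | exact: continuous_logratio]. Qed.

Lemma continuous_radial (q : R) : 0 < q -> 0 < logratio q -> {for q, continuous radial}.
Proof.
move=> q0 l0; have [drad_q _] := is_derive_radial _ q0 l0.
by apply: differentiable_continuous; rewrite -derivable1_diffP.
Qed.

Lemma continuous_dradial (q : R) : 0 < q -> 0 < logratio q -> {for q, continuous dradial}.
Proof.
move=> q0 l0; have qi := inv_continuous (lt0r_neq0 q0).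
have li := continuous_logratioV _ q0 l0.
have E : dradial = fun y => (4^-1 * ((logratio y)^-1 * (logratio y)^-1) - N / 2 -
    2^-1 * (logratio y)^-1) * (y^-1 * y^-1).
  by apply/funext => y; rewrite /dradial !expr2 !invfM.
rewrite E.
exact: (cvgM (cvgB (cvgB (cvgM (cvg_cst (4^-1 : R)) (cvgM li li)) (cvg_cst (N / 2)))
  (cvgM (cvg_cst (2^-1 : R)) li)) (cvgM qi qi)).
Qed.

Lemma continuous_potential (q : R) : 0 < q -> 0 < logratio q -> {for q, continuous potential}.
Proof.
move=> q0 l0; have qi := inv_continuous (lt0r_neq0 q0).
have li := continuous_logratioV _ q0 l0.
have E : potential = fun y => (N ^+ 2 / 4 + 4^-1 * ((logratio y)^-1 * (logratio y)^-1)) * y^-1.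
  by apply/funext => y; rewrite /potential !expr2 !invfM.
rewrite E.
exact: (cvgM (cvgD (cvg_cst (N ^+ 2 / 4)) (cvgM (cvg_cst (4^-1 : R)) (cvgM li li))) qi).
Qed.

(** The part of the ground state equation that involves [q] alone: the right-hand
    side is what [- div F - |F|^2] reduces to in [drift_identity]. *)
Lemma potentialE (q : R) : 0 < q -> 0 < logratio q ->
  potential q = (N + 2) * radial q + q * (2 * dradial q - radial q ^+ 2).
Proof.
by move=> q0 l0; rewrite /potential /radial /dradial; field; rewrite !gt_eqF.
Qed.

End radial_part.

End ground_state.

Section halfspace.
Context {R : realType} {n : nat}.
Variable L : R.
Local Notation N := (n.+1%:R : R).
Local Notation e_ i := (delta_mx ord0 i : 'rV[R]_n.+1).

(** The logarithmic gradient of the ground state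
    [x_N |x|^(-N/2) (log (L/|x|))^(1/2)]. *)
Definition drift (i : 'I_n.+1) (x : 'rV[R]_n.+1) : R :=
  (i == ord_max)%:R * (x ord0 i)^-1 - x ord0 i * radial N L (sqnorm x).

Definition partial_drift (i : 'I_n.+1) (x : 'rV[R]_n.+1) : R :=
  - (i == ord_max)%:R * (x ord0 i)^-1 ^+ 2 -
  (radial N L (sqnorm x) + 2 * x ord0 i ^+ 2 * dradial N L (sqnorm x)).

Lemma is_derive_drift i (x : 'rV[R]_n.+1) :
  0 < x ord0 ord_max -> 0 < sqnorm x -> 0 < logratio L (sqnorm x) ->
  is_derive x (e_ i) (drift i) (partial_drift i x).
Proof.
move=> xN q0 l0.
have drad_x := is_derive_comp_row _ _ _ _ _ _ _ (is_derive_sqnorm _ i x)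
  (is_derive_radial N L _ q0 l0).
have dxi := is_derive_coord _ i i x.
have dr := is_deriveM dxi drad_x.
rewrite eqxx in dxi dr.
have [im|im] := eqVneq i ord_max.
  have xi0 : x ord0 i != 0 by rewrite im gt_eqF.
  have dinv : is_derive x (e_ i) (fun y : 'rV[R]_n.+1 => (y ord0 i)^-1) (- (x ord0 i) ^- 2).
    have := is_derive_comp_row _ _ _ _ _ _ _ dxi
      (is_deriveV xi0 (is_derive_id (x ord0 i) (1 : R))).
    by move=> /is_derive_eq; apply; rewrite /GRing.scale /= !mulr1.
  rewrite (_ : drift i = (fun y : 'rV[R]_n.+1 => (y ord0 i)^-1) -
     (fun y : 'rV[R]_n.+1 => y ord0 i) * (fun y => radial N L (sqnorm y))); last first.
    by apply/funext => y; rewrite /drift im eqxx mul1r.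
  apply: (is_derive_eq (is_deriveB dinv dr)).
  rewrite /partial_drift im eqxx /GRing.scale /= exprVn; ring.
rewrite (_ : drift i =
    - ((fun y : 'rV[R]_n.+1 => y ord0 i) * (fun y => radial N L (sqnorm y)))); last first.
  by apply/funext => y; rewrite /drift (negPf im) mul0r sub0r.
apply: (is_derive_eq (is_deriveN dr)).
rewrite /partial_drift (negPf im) /GRing.scale /=; ring.
Qed.

Lemma continuous_inv_coord i (x : 'rV[R]_n.+1) : 0 < x ord0 ord_max ->
  {for x, continuous (fun y : 'rV[R]_n.+1 => (i == ord_max)%:R * (y ord0 i)^-1)}.
Proof.
move=> xN; have [->|im] := eqVneq i ord_max.
  exact: (cvgM (cvg_cst (1 : R)) (cvgV (lt0r_neq0 xN) (@coord_continuous R 1 _ ord0 ord_max x))).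
have -> : (fun y : 'rV[R]_n.+1 => false%:R * (y ord0 i)^-1) = cst (0 : R).
  by apply/funext => y; rewrite mul0r.
exact: cst_continuous.
Qed.

Lemma continuous_comp_sqnorm (f : R -> R) (x : 'rV[R]_n.+1) :
  {for sqnorm x, continuous f} -> {for x, continuous (fun y => f (sqnorm y))}.
Proof. by move=> cf; apply: continuous_comp => //; exact: continuous_sqnorm. Qed.

Lemma continuous_drift i (x : 'rV[R]_n.+1) :
  0 < x ord0 ord_max -> 0 < sqnorm x -> 0 < logratio L (sqnorm x) ->
  {for x, continuous (drift i)}.
Proof.
move=> xN q0 l0; have cr := continuous_comp_sqnorm _ _ (continuous_radial N L _ q0 l0).
exact: (cvgB (continuous_inv_coord i x xN) (cvgM (@coord_continuous R 1 _ ord0 i x) cr)).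
Qed.

Lemma continuous_partial_drift i (x : 'rV[R]_n.+1) :
  0 < x ord0 ord_max -> 0 < sqnorm x -> 0 < logratio L (sqnorm x) ->
  {for x, continuous (partial_drift i)}.
Proof.
move=> xN q0 l0; have cr := continuous_comp_sqnorm _ _ (continuous_radial N L _ q0 l0).
have cdr := continuous_comp_sqnorm _ _ (continuous_dradial N L _ q0 l0).
have ci := continuous_inv_coord i x xN.
have cx := @coord_continuous R 1 _ ord0 i x.
have E : partial_drift i = fun y =>
    - ((i == ord_max)%:R * (y ord0 i)^-1 * ((i == ord_max)%:R * (y ord0 i)^-1)) -
    (radial N L (sqnorm y) + 2 * (y ord0 i * y ord0 i) * dradial N L (sqnorm y)).
  apply/funext => y; rewrite /partial_drift -!expr2; congr (_ - _).
  by case: (i == ord_max); rewrite ?mul1r ?mulN1r ?oppr0 ?mul0r ?expr0n //= oppr0.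
rewrite E.
exact: (cvgB (cvgN (cvgM ci ci)) (cvgD cr (cvgM (cvgM (cvg_cst (2:R)) (cvgM cx cx)) cdr))).
Qed.

(** The equation [- Laplacian w = V w] for the ground state, written for its
    logarithmic gradient. The terms in [x_N^-2] cancel between the divergence and
    the square, and the cross terms of the square contribute the [2] in
    [potentialE]. *)
Lemma drift_identity (x : 'rV[R]_n.+1) :
  0 < x ord0 ord_max -> 0 < sqnorm x -> 0 < logratio L (sqnorm x) ->
  potential N L (sqnorm x) = - \sum_i partial_drift i x - \sum_i drift i x ^+ 2.
Proof.
move=> xN q0 l0; rewrite potentialE // -sumrN -sumrB.
rewrite /partial_drift /drift.
move: (radial _ _ _) (dradial _ _ _) => a d.
rewrite (eq_bigr (fun i => a + (i == ord_max)%:R * (2 * a) +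
    x ord0 i ^+ 2 * (2 * d - a ^+ 2))); last first.
  move=> i _; have [->|im] := eqVneq i ord_max; last by rewrite /=; ring.
  by rewrite /=; field; rewrite gt_eqF.
rewrite !big_split /= -mulr_suml -mulr_suml sumr_const card_ord -[a *+ _]mulr_natl.
rewrite (bigD1 ord_max) //= eqxx big1; last by move=> i /negPf->.
by rewrite addr0 mul1r [in LHS]mulrDl.
Qed.

End halfspace.

Lemma logratio_enorm (R : realType) n (L : R) (x : 'rV[R]_n) :
  0 < L -> 0 < enorm x -> logratio L (sqnorm x) = ln (L / enorm x).
Proof.
move=> L0 x0; rewrite /logratio -enorm_sqr lnXn // ln_div ?posrE //.
by rewrite -[ln (enorm x) *+ 2]mulr_natr mulfK.
Qed.

(** * The inequality *)

(* The space dimension is N = n.+1; the last coordinate has index ord_max. *)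
Theorem theorem2p2 (R : realType) (n : nat) (hN : (2 <= n.+1)%N)
  (Om : set 'rV[R]_n.+1)
  (hOm : lipschitz_domain Om)
  (h0 : boundary Om 0)
  (hsmooth : smooth_boundary_at Om 0)
  (hhalf : forall x, Om x -> 0 < x ord0 ord_max)
  (L : R) (hL0 : 0 < L)
  (hL : (ereal_sup [set (enorm x)%:E | x in closure Om] < L%:E)%E)
  (v : 'rV[R]_n.+1 -> R) (gradv : 'rV[R]_n.+1 -> 'rV[R]_n.+1)
  (hv : H10 Om v gradv) :
  (\int[lebesgue_row n.+1]_(x in Om) (enorm (gradv x) ^+ 2)%:E >=
   (n.+1%:R ^+ 2 / 4)%:E *
     \int[lebesgue_row n.+1]_(x in Om) (v x ^+ 2 / enorm x ^+ 2)%:E +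
   (1 / 4)%:E *
     \int[lebesgue_row n.+1]_(x in Om)
       (v x ^+ 2 / (enorm x ^+ 2 * ln (L / enorm x) ^+ 2))%:E)%E.
Proof.
have [oOm _ _] := hOm.
have mOm : measurable Om by exact: open_measurable_row.
have q0 x : Om x -> 0 < sqnorm x.
  move=> /hhalf xN; rewrite /sqnorm (bigD1 ord_max) //= ltr_wpDr ?exprn_gt0 //.
  by apply: sumr_ge0 => i _; exact: sqr_ge0.
have x0 x : Om x -> 0 < enorm x by move=> /q0 q; rewrite sqrtr_gt0.
have xL x : Om x -> enorm x < L.
  move=> Omx; rewrite -lte_fin; apply: le_lt_trans hL.
  by apply: ereal_sup_ubound; exists x => //; exact: subset_closure.
have l0 x : Om x -> 0 < logratio L (sqnorm x).
  move=> Omx; rewrite logratio_enorm ?x0 // ln_gt0 // ltr_pdivlMr ?x0 // mul1r.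
  exact: xL.
pose V (x : 'rV[R]_n.+1) := potential n.+1%:R L (sqnorm x).
have mV : measurable_fun Om V.
  apply: open_continuous_measurable_row => // x Omx.
  by apply: continuous_comp_sqnorm; apply: continuous_potential; [exact: q0 | exact: l0].
have V0 x : Om x -> 0 <= V x.
  move=> Omx; apply: divr_ge0; last exact/ltW/q0.
  by rewrite addr_ge0 // ?invr_ge0 mulr_ge0 ?sqr_ge0.
have main := hardy_closure Om V v gradv oOm mV V0.
have mv : measurable_fun Om v by have [[[]]] := hv.
have mf (f : R -> R) : (forall x, Om x -> {for sqnorm x, continuous f}) ->
    measurable_fun Om (fun x => (v x ^+ 2 * f (sqnorm x))%:E).
  move=> cf; apply/measurable_EFinP; apply: measurable_funM.
    exact: measurable_funX.
  apply: open_continuous_measurable_row => // x Omx.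
  by apply: continuous_comp_sqnorm; exact: cf.
have c1 x : Om x -> {for sqnorm x, continuous (@GRing.inv R)}.
  by move=> Omx; apply: inv_continuous; exact/lt0r_neq0/q0.
have c2 x : Om x -> {for sqnorm x, continuous
    (fun q : R => q^-1 * ((logratio L q)^-1 * (logratio L q)^-1))}.
  move=> Omx; have li := continuous_logratioV L _ (q0 _ Omx) (l0 _ Omx).
  exact: (cvgM (c1 _ Omx) (cvgM li li)).
rewrite (eq_integral (fun x => (v x ^+ 2 * (sqnorm x)^-1)%:E)); last first.
  by move=> x _; rewrite enorm_sqr.
rewrite [X in (_ + _ * X)%E](eq_integral (fun x => (v x ^+ 2 *
    ((sqnorm x)^-1 * ((logratio L (sqnorm x))^-1 * (logratio L (sqnorm x))^-1)))%:E)); last first.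
  move=> x; rewrite inE => Omx.
  by rewrite -logratio_enorm ?x0 // enorm_sqr invfM expr2 invfM.
(* the two integrals on the smaller side are merged into one, with weight [V] *)
have m1 := mf _ c1.
have m2 := mf _ c2.
have p1 x : Om x -> (0 <= (v x ^+ 2 * (sqnorm x)^-1)%:E)%E.
  by move=> Omx; rewrite lee_fin mulr_ge0 ?sqr_ge0 // invr_ge0 ltW // q0.
have p2 x : Om x -> (0 <= (v x ^+ 2 *
    ((sqnorm x)^-1 * ((logratio L (sqnorm x))^-1 * (logratio L (sqnorm x))^-1)))%:E)%E.
  move=> Omx; rewrite lee_fin mulr_ge0 ?sqr_ge0 // -expr2 mulr_ge0 ?sqr_ge0 //.
  by rewrite invr_ge0 ltW // q0.
rewrite -!ge0_integralZl_EFin //.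
rewrite -ge0_integralD //; try exact: measurable_funeM.
2: by move=> x Omx; rewrite mule_ge0 ?p1.
2: by move=> x Omx; rewrite mule_ge0 ?p2.
rewrite (eq_integral (fun x => (V x * v x ^+ 2)%:E)); last first.
  move=> x; rewrite inE => Omx; rewrite -!EFinM -EFinD; congr EFin.
  have := q0 _ Omx; have := l0 _ Omx; rewrite /V /potential.
  set l := logratio _ _; set q := sqnorm x => lgt qgt.
  by field; rewrite !gt_eqF.
apply: main => // phi tphi.
apply: (hardy_vector_field Om (drift L) (partial_drift L)) => //.
- by move=> i x Omx; apply: is_derive_drift; [exact: hhalf|exact: q0|exact: l0].
- by move=> i x Omx; apply: continuous_drift; [exact: hhalf|exact: q0|exact: l0].
- by move=> i x Omx; apply: continuous_partial_drift; [exact: hhalf|exact: q0|exact: l0].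
- by move=> x Omx; rewrite -drift_identity //; [exact: hhalf|exact: q0|exact: l0].
Qed.
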